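(* (Mean-field stochastic bounded real lemma.) Let $K\in\mathbb{N}$ and $\gamma>0$. Consider the mean-field stochastic system, for $k\in N_K=\{0,1,\dots,K\}$, $$\begin{cases} x(k+1)=A(k)x(k)+\tilde A(k)\mathbf{E}x(k)+B(k)\nu(k)+\tilde B(k)\mathbf{E}\nu(k)\\ \qquad\qquad+[C(k)x(k)+\tilde C(k)\mathbf{E}x(k)+D(k)\nu(k)+\tilde D(k)\mathbf{E}\nu(k)]\,\omega(k),\\ z(k)=\Phi(k)x(k),\qquad x(0)=x_0\in\mathbb{R}^n.\end{cases}$$ Suppose that the constrained backward difference equation, for $k\in N_K$, $$\begin{cases}P(k)=L(P(k+1))-G(P(k+1))H(P(k+1))^{-1}G(P(k+1))^T,\\ Q(k)=\tilde L(P(k+1),Q(k+1))\\ \qquad\quad-\tilde G(P(k+1),Q(k+1))\tilde H(P(k+1),Q(k+1))^{-1}\tilde G(P(k+1),Q(k+1))^T,\\ P(K+1)=Q(K+1)=0,\\ H(P(k+1))>0,\quad \tilde H(P(k+1),Q(k+1))>0\end{cases}$$ has a unique solution $(P_1(k),Q_1(k))$. Then $\|L_K\|<\gamma$, and $Q_1(k)\le 0$ for all $k\in N_K$.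
   Context: Setting: $x(k)\in\mathbb{R}^n$ is the state, $\nu(k)\in\mathbb{R}^l$ the disturbance, $z(k)\in\mathbb{R}^m$ the output. For each $k\in N_K$, $A(k),\tilde A(k),C(k),\tilde C(k)\in\mathbb{R}^{n\times n}$, $B(k),\tilde B(k),D(k),\tilde D(k)\in\mathbb{R}^{n\times l}$ and $\Phi(k)\in\mathbb{R}^{m\times n}$ are given deterministic matrices. The initial value $x_0$ is deterministic. $\mathbf{E}$ denotes expectation. $\{\omega(k)\}_{k\in N_K}$ are real random variables on a complete probability space $(\Omega,\mathcal{F},\mu)$ with $\mathbf{E}\omega(s)=0$ and $\mathbf{E}[\omega(s)\omega(t)]=\delta_{st}$ (Kronecker delta). Let $\mathcal{F}_k=\sigma(\omega(0),\dots,\omega(k))$, with $\mathcal{F}_{-1}$ trivial; $\omega(k)$ is independent of $\mathcal{F}_{k-1}$ for every $k$. $l^2_\omega(N_K,\mathbb{R}^p)$ is the space of finite sequences $(y(k))_{k\in N_K}$ of square-integrable $\mathbb{R}^p$-valued random vectors with $y(k)$ being $\mathcal{F}_{k-1}$-measurable, with norm $\big(\sum_{k=0}^K\mathbf{E}\|y(k)\|^2\big)^{1/2}$. Disturbances $\nu$ range over $l^2_\omega(N_K,\mathbb{R}^l)$, and $x(k;x_0,\nu)$ denotes the solution with initial value $x_0$ and disturbance $\nu$. The perturbed operator $L_K:l^2_\omega(N_K,\mathbb{R}^l)\to l^2_\omega(N_K,\mathbb{R}^m)$ is $(L_K\nu)(k)=\Phi(k)x(k;0,\nu)$, with norm $$\|L_K\|=\sup_{\nu\in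 l^2_\omega(N_K,\mathbb{R}^l),\,\nu\ne0}\frac{\big(\sum_{k=0}^K\mathbf{E}\|\Phi(k)x(k;0,\nu)\|^2\big)^{1/2}}{\big(\sum_{k=0}^K\mathbf{E}\|\nu(k)\|^2\big)^{1/2}}.$$ Notation: $\mathbb{A}=A+\tilde A$, $\mathbb{B}=B+\tilde B$, $\mathbb{C}=C+\tilde C$, $\mathbb{D}=D+\tilde D$ (each at time $k$). Writing $P=P(k+1)$, $Q=Q(k+1)$ and evaluating all coefficients at time $k$: $L(P)=A^TPA+C^TPC-\Phi^T\Phi$, $G(P)=A^TPB+C^TPD$, $H(P)=\gamma^2I_l+B^TPB+D^TPD$, $\tilde L(P,Q)=\mathbb{A}^TQ\mathbb{A}+\mathbb{C}^TP\mathbb{C}-\Phi^T\Phi$, $\tilde G(P,Q)=\mathbb{A}^TQ\mathbb{B}+\mathbb{C}^TP\mathbb{D}$, $\tilde H(P,Q)=\gamma^2I_l+\mathbb{B}^TQ\mathbb{B}+\mathbb{D}^TP\mathbb{D}$. The unknowns $P(k),Q(k)$ are real symmetric $n\times n$ matrices; for symmetric $X$, $X>0$ ($X\ge0$) means positive definite (semidefinite), and $X\le0$ means $-X\ge0$. *)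

(* Defs.v *)
From HB Require Import structures.
From mathcomp Require Import all_boot all_order all_algebra.
From mathcomp Require Import all_classical all_reals all_analysis.

Set Implicit Arguments.
Unset Strict Implicit.
Unset Printing Implicit Defensive.

Import Order.TTheory GRing.Theory Num.Theory.

Local Open Scope classical_set_scope.
Local Open Scope ring_scope.

(* Sequences indexed by {0, ..., K} are functions on nat; every hypothesis,
   norm and equation below only involves their values at times k <= K
   (k <= K + 1 for the unknowns of the difference equation). *)

Section linear_algebra.
Context (R : realType).

Definition posdefmx n (M : 'M[R]_n) : Prop :=
  M^T = M /\ forall v : 'cV[R]_n, v != 0 -> 0 < (v^T *m M *m v) 0 0.

Definition possemidefmx n (M : 'M[R]_n) : Prop :=
  M^T = M /\ forall v : 'cV[R]_n, 0 <= (v^T *m M *m v) 0 0.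

(* Squared Euclidean norm; the library norm on matrices is the max norm. *)
Definition sqnorm n (v : 'cV[R]_n) : R := \sum_(i < n) v i 0 ^+ 2.

End linear_algebra.

(* The suffix t stands for the tilde of the mean-field coefficients. *)
Record mf_system (R : realType) (n l m : nat) := MfSystem {
  cA : nat -> 'M[R]_n;       cAt : nat -> 'M[R]_n;
  cB : nat -> 'M[R]_(n, l);  cBt : nat -> 'M[R]_(n, l);
  cC : nat -> 'M[R]_n;       cCt : nat -> 'M[R]_n;
  cD : nat -> 'M[R]_(n, l);  cDt : nat -> 'M[R]_(n, l);
  cPhi : nat -> 'M[R]_(m, n)
}.

Section noise.
Context (R : realType) (d : measure_display) (T : measurableType d).
Variable mu : probability T R.

(* sigma(omega 0, ..., omega (k - 1)), that is F_(k-1); trivial for k = 0. *)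
Definition past (omega : nat -> {RV mu >-> R}) (k : nat) : set (set T) :=
  <<s \bigcup_(j in [set j | (j < k)%N])
        preimage_set_system setT (omega j) measurable >>.

Definition mf_noise (K : nat) (omega : nat -> {RV mu >-> R}) : Prop :=
  [/\ forall s, (s <= K)%N -> ('E_mu[omega s] = 0)%E,
      forall s t, (s <= K)%N -> (t <= K)%N ->
        ('E_mu[fun w => (omega s w * omega t w)%R] = (s == t)%:R%:E)%E
    & forall k, (k <= K)%N -> forall (U : set R) (F : set T),
        measurable U -> past omega k F ->
        mu (omega k @^-1` U `&` F) = (mu (omega k @^-1` U) * mu F)%E].

(* Componentwise expectation of a random vector. *)
Definition vexp p (X : T -> 'cV[R]_p) : 'cV[R]_p :=
  \col_i fine ('E_mu[fun w => X w i 0%R])%E.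

Definition l2w (K : nat) (omega : nat -> {RV mu >-> R}) p
    (y : nat -> T -> 'cV[R]_p) : Prop :=
  forall k, (k <= K)%N ->
    (forall i (U : set R), measurable U ->
       past omega k ((fun w => y k w i 0) @^-1` U)) /\
    mu.-integrable setT (fun w => (sqnorm (y k w))%:E).

Definition l2norm (K : nat) p (y : nat -> T -> 'cV[R]_p) : \bar R :=
  ((\sum_(k < K.+1) 'E_mu[fun w => sqnorm (y k w)]) `^ (2^-1)%R)%E.

Section system.
Context (n l m : nat).
Variable S : mf_system R n l m.

(* The solution x(k; x0, nu). *)
Fixpoint mf_state (omega : nat -> {RV mu >-> R}) (x0 : 'cV[R]_n)
    (nu : nat -> T -> 'cV[R]_l) (k : nat) : T -> 'cV[R]_n :=
  if k is j.+1 then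
    let x := mf_state omega x0 nu j in
    fun w =>
      cA S j *m x w + cAt S j *m vexp x
      + cB S j *m nu j w + cBt S j *m vexp (nu j)
      + omega j w *: (cC S j *m x w + cCt S j *m vexp x
                      + cD S j *m nu j w + cDt S j *m vexp (nu j))
  else fun=> x0.

Definition mf_output (omega : nat -> {RV mu >-> R}) (x0 : 'cV[R]_n)
    (nu : nat -> T -> 'cV[R]_l) (k : nat) : T -> 'cV[R]_m :=
  fun w => cPhi S k *m mf_state omega x0 nu k w.

(* The perturbed operator L_K; time indices are restricted in l2norm. *)
Definition pert_op (omega : nat -> {RV mu >-> R})
    (nu : nat -> T -> 'cV[R]_l) : nat -> T -> 'cV[R]_m :=
  mf_output omega 0 nu.

(* Elements of l2w are not quotiented by a.e. equality, so that nu <> 0 in the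
   Hilbert space reads l2norm nu != 0. The supremum and the quotients live in
   \bar R: no finiteness is assumed. *)
Definition pert_norm (K : nat) (omega : nat -> {RV mu >-> R}) : \bar R :=
  ereal_sup [set (l2norm K (pert_op omega nu) / l2norm K nu)%E |
             nu in [set nu : nat -> T -> 'cV[R]_l |
                    l2w K omega nu /\ l2norm K nu != 0%E]].

End system.
End noise.

Section difference_equation.
Context (R : realType) (n l m : nat).
Variables (S : mf_system R n l m) (gamma : R).

Definition sA (k : nat) := cA S k + cAt S k.
Definition sB (k : nat) := cB S k + cBt S k.
Definition sC (k : nat) := cC S k + cCt S k.
Definition sD (k : nat) := cD S k + cDt S k.

(* Below, P and Q stand for P(k+1) and Q(k+1). *)
Definition Lop (k : nat) (P : 'M[R]_n) : 'M[R]_n :=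
  (cA S k)^T *m P *m cA S k + (cC S k)^T *m P *m cC S k
  - (cPhi S k)^T *m cPhi S k.
Definition Gop (k : nat) (P : 'M[R]_n) : 'M[R]_(n, l) :=
  (cA S k)^T *m P *m cB S k + (cC S k)^T *m P *m cD S k.
Definition Hop (k : nat) (P : 'M[R]_n) : 'M[R]_l :=
  (gamma ^+ 2)%:M + (cB S k)^T *m P *m cB S k + (cD S k)^T *m P *m cD S k.

Definition Ltop (k : nat) (P Q : 'M[R]_n) : 'M[R]_n :=
  (sA k)^T *m Q *m sA k + (sC k)^T *m P *m sC k - (cPhi S k)^T *m cPhi S k.
Definition Gtop (k : nat) (P Q : 'M[R]_n) : 'M[R]_(n, l) :=
  (sA k)^T *m Q *m sB k + (sC k)^T *m P *m sD k.
Definition Htop (k : nat) (P Q : 'M[R]_n) : 'M[R]_l :=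
  (gamma ^+ 2)%:M + (sB k)^T *m Q *m sB k + (sD k)^T *m P *m sD k.

Definition backward_solution (K : nat) (P Q : nat -> 'M[R]_n) : Prop :=
  [/\ forall k, (k <= K.+1)%N -> (P k)^T = P k /\ (Q k)^T = Q k,
      P K.+1 = 0 /\ Q K.+1 = 0
    & forall k, (k <= K)%N ->
      [/\ P k = Lop k (P k.+1)
                - Gop k (P k.+1) *m invmx (Hop k (P k.+1))
                    *m (Gop k (P k.+1))^T,
          Q k = Ltop k (P k.+1) (Q k.+1)
                - Gtop k (P k.+1) (Q k.+1)
                    *m invmx (Htop k (P k.+1) (Q k.+1))
                    *m (Gtop k (P k.+1) (Q k.+1))^T,
          posdefmx (Hop k (P k.+1))
        & posdefmx (Htop k (P k.+1) (Q k.+1))]].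

Definition unique_backward_solution (K : nat) (P Q : nat -> 'M[R]_n) : Prop :=
  backward_solution K P Q /\
  forall P' Q', backward_solution K P' Q' ->
    forall k, (k <= K.+1)%N -> P' k = P k /\ Q' k = Q k.

End difference_equation.

(* Main.v *)
From HB Require Import structures.
Require Import Defs.
From mathcomp Require Import all_boot all_order all_algebra.
From mathcomp Require Import all_classical all_reals all_analysis.
From mathcomp Require Import measurable_realfun ring lra.

Set Implicit Arguments.
Unset Strict Implicit.
Unset Printing Implicit Defensive.

Import Order.TTheory GRing.Theory Num.Theory.

Local Open Scope classical_set_scope.
Local Open Scope ring_scope.

(* Split the state and the input into mean and deviation. Since omega(k) is
   independent of the past, centred and of variance 1, quadratic moments obey a
   deterministic recursion in which P weighs the deviation and Q the mean.
   Completing squares with the two Riccati equations and telescoping from the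
   zero initial state to the zero terminal condition gives
     E|z|^2 = gamma^2 E|nu|^2 - r   (summed over time),
   where r >= 0 is a sum of squares weighted by H > 0 and Ht > 0. The input
   deviates from a linear feedback of the state by a term controlled by r, so
   running the system forward from 0 yields E|nu|^2 <= C r with C independent
   of nu; hence |L_K|^2 <= gamma^2 - 1/C. Nonpositivity of Q is a backward
   induction on the Riccati equations, obtained from the completed square with
   zero input. *)

(** * Bilinear forms, positive definite matrices and Euclidean bounds *)

Section bilinear_forms.
Context (R : realType).

Definition bform p q (P : 'M[R]_(p, q)) (u : 'cV[R]_p) (v : 'cV[R]_q) : R :=
  (u^T *m P *m v) 0 0.

Lemma bformE p q (P : 'M[R]_(p, q)) u v :
  bform P u v = \sum_i \sum_j P i j * (u i 0 * v j 0).
Proof.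
rewrite /bform -mulmxA mxE; apply: eq_bigr => i _; rewrite !mxE big_distrr /=.
by apply: eq_bigr => j _; rewrite mulrCA.
Qed.

Lemma bformDl p q (P : 'M[R]_(p, q)) u u' v :
  bform P (u + u') v = bform P u v + bform P u' v.
Proof. by rewrite /bform raddfD !mulmxDl mxE. Qed.

Lemma bformDr p q (P : 'M[R]_(p, q)) u v v' :
  bform P u (v + v') = bform P u v + bform P u v'.
Proof. by rewrite /bform mulmxDr mxE. Qed.

Lemma bformZl p q (P : 'M[R]_(p, q)) a u v :
  bform P (a *: u) v = a * bform P u v.
Proof. by rewrite /bform linearZ /= -!scalemxAl mxE. Qed.

Lemma bformZr p q (P : 'M[R]_(p, q)) a u v :
  bform P u (a *: v) = a * bform P u v.
Proof. by rewrite /bform -!scalemxAr mxE. Qed.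

Lemma bform0l p q (P : 'M[R]_(p, q)) v : bform P 0 v = 0.
Proof. by rewrite -(scale0r 0) bformZl mul0r. Qed.

Lemma bform0r p q (P : 'M[R]_(p, q)) u : bform P u 0 = 0.
Proof. by rewrite -(scale0r 0) bformZr mul0r. Qed.

Lemma bformDm p q (P P' : 'M[R]_(p, q)) u v :
  bform (P + P') u v = bform P u v + bform P' u v.
Proof. by rewrite /bform mulmxDr mulmxDl mxE. Qed.

Lemma bformNm p q (P : 'M[R]_(p, q)) u v : bform (- P) u v = - bform P u v.
Proof. by rewrite /bform mulmxN mulNmx mxE. Qed.

Lemma bform0m p q (u : 'cV[R]_p) (v : 'cV[R]_q) : bform 0 u v = 0.
Proof. by rewrite /bform mulmx0 mul0mx mxE. Qed.

Lemma bform_scalar p (a : R) (u v : 'cV[R]_p) :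
  bform a%:M u v = a * bform 1%:M u v.
Proof. by rewrite /bform -!mulmxA !mul_scalar_mx scale1r -scalemxAr mxE. Qed.

Lemma bform_tr p q (P : 'M[R]_(p, q)) u v : bform P^T v u = bform P u v.
Proof.
rewrite /bform; have <- : (u^T *m P *m v)^T = v^T *m P^T *m u.
  by rewrite !trmx_mul trmxK mulmxA.
by rewrite mxE.
Qed.

Lemma bform_sym p (P : 'M[R]_p) u v : P^T = P -> bform P u v = bform P v u.
Proof. by move=> sP; rewrite -bform_tr sP. Qed.

Lemma bform_mulmx p q r s (P : 'M[R]_(p, q)) (A : 'M[R]_(p, r))
    (B : 'M[R]_(q, s)) u v :
  bform P (A *m u) (B *m v) = bform (A^T *m P *m B) u v.
Proof. by rewrite /bform trmx_mul !mulmxA. Qed.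

Lemma bform_mulmxr p q r (P : 'M[R]_(p, q)) (B : 'M[R]_(q, r)) u v :
  bform P u (B *m v) = bform (P *m B) u v.
Proof. by rewrite /bform !mulmxA. Qed.

Lemma sqnormE p (v : 'cV[R]_p) : sqnorm v = bform 1%:M v v.
Proof.
rewrite /bform mulmx1 mxE; apply: eq_bigr => i _.
by rewrite !mxE expr2.
Qed.

Lemma sqnorm_ge0 p (v : 'cV[R]_p) : 0 <= sqnorm v.
Proof. by apply: sumr_ge0 => i _; exact: sqr_ge0. Qed.

Lemma sqnormD_le p (u v : 'cV[R]_p) :
  sqnorm (u + v) <= 2 * (sqnorm u + sqnorm v).
Proof.
rewrite /sqnorm -big_split big_distrr /=; apply: ler_sum => i _; rewrite mxE.
have := sqr_ge0 (u i 0 - v i 0); nra.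
Qed.

Lemma posdefmx_ge0 p (H : 'M[R]_p) v : posdefmx H -> 0 <= bform H v v.
Proof.
case=> _ H_gt0; have [->|v0] := eqVneq v 0; first by rewrite bform0l.
exact/ltW/H_gt0.
Qed.

(** A row [w] with [w *m H = 0] satisfies [w *m H *m w^T = 0], so positivity forces [w = 0]. *)
Lemma posdefmx_unit p (H : 'M[R]_p) : posdefmx H -> H \in unitmx.
Proof.
case=> sH H_gt0; rewrite -row_free_unit -kermx_eq0; apply/eqP/row_matrixP => i.
rewrite row0; apply/eqP; apply: contraT => w0.
have /H_gt0 : (row i (kermx H))^T != 0.
  by apply: contraNneq w0 => /(congr1 trmx); rewrite trmxK trmx0 => ->.
have /sub_kermxP wH : (row i (kermx H) <= kermx H)%MS by exact: row_sub.
by rewrite trmxK wH mul0mx mxE ltxx.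
Qed.

Lemma posdefmx_CauchySchwarz p (H : 'M[R]_p) u v : posdefmx H ->
  bform H u v ^+ 2 <= bform H u u * bform H v v.
Proof.
move=> pH; have [->|u0] := eqVneq u 0; first by rewrite !bform0l expr0n mul0r.
have a_gt0 : 0 < bform H u u by case: pH => _; exact.
(* With [a], [b], [d] as named below, the form at [a v - b u] equals [a (a d - b^2)], and [a > 0]
   cancels. *)
have := posdefmx_ge0 (bform H u u *: v + (- bform H u v) *: u) pH.
rewrite !(bformDl, bformDr, bformZl, bformZr) (@bform_sym _ _ v u (proj1 pH)).
set a := bform H u u in a_gt0 *; set b := bform H u v; set d := bform H v v.
move=> h; rewrite -subr_ge0 -(pmulr_rge0 _ a_gt0); nra.
Qed.

(* [v_i] is the [H]-inner product of [v] with [H^-1 e_i]. *)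
Lemma sqnorm_le_posdefmx p (H : 'M[R]_p) : posdefmx H ->
  exists2 c : R, 0 <= c & forall v, sqnorm v <= c * bform H v v.
Proof.
move=> pH; have uH := posdefmx_unit pH.
pose w i := invmx H *m delta_mx i 0 : 'cV[R]_p.
exists (\sum_i bform H (w i) (w i)).
  by apply: sumr_ge0 => i _; exact: posdefmx_ge0.
move=> v; rewrite big_distrl /=; apply: ler_sum => i _.
suff -> : v i 0 = bform H (w i) v by exact: posdefmx_CauchySchwarz.
rewrite bform_sym ?(proj1 pH)// bform_mulmxr mulmxV// /bform mulmx1.
by rewrite -colE !mxE.
Qed.

Lemma posdefmx1 p : posdefmx (1%:M : 'M[R]_p).
Proof.
split=> [|v v0]; first by rewrite trmx1.
change (0 < bform 1%:M v v); rewrite -sqnormE lt_def sqnorm_ge0 andbT.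
apply: contraNneq v0 => /eqP.
rewrite psumr_eq0 => [/allP h|i _]; last exact: sqr_ge0.
apply/eqP/matrixP => i j; rewrite mxE (ord1 j).
by have := h i (mem_index_enum i); rewrite sqrf_eq0 => /eqP.
Qed.

(** Cauchy-Schwarz on each row; the constant is the squared Frobenius norm of [A]. *)
Lemma sqnorm_mulmx_le p q (A : 'M[R]_(p, q)) :
  exists2 c : R, 0 <= c & forall v, sqnorm (A *m v) <= c * sqnorm v.
Proof.
exists (\sum_i sqnorm (row i A)^T).
  by apply: sumr_ge0 => i _; exact: sqnorm_ge0.
move=> v; rewrite {1}/sqnorm big_distrl /=; apply: ler_sum => i _.
suff -> : (A *m v) i 0 = bform 1%:M (row i A)^T v.
  by rewrite !sqnormE; exact/posdefmx_CauchySchwarz/posdefmx1.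
by rewrite /bform trmxK mulmx1 -row_mul [RHS]mxE.
Qed.

Lemma sqnorm_affine_le p q r (A : 'M[R]_(p, q)) (B : 'M[R]_(p, r)) :
  exists2 c : R, 0 <= c &
    forall x v, sqnorm (A *m x + B *m v) <= c * (sqnorm x + sqnorm v).
Proof.
have [a a0 Aa] := sqnorm_mulmx_le A; have [b b0 Bb] := sqnorm_mulmx_le B.
exists (2 * (a + b)) => [|x v]; first by rewrite mulr_ge0 ?addr_ge0.
apply: le_trans (sqnormD_le _ _) _; rewrite -mulrA ler_pM2l//.
have := Aa x; have := Bb v; have := sqnorm_ge0 x; have := sqnorm_ge0 v; nra.
Qed.

End bilinear_forms.

(** * One stage of the Riccati equations *)

Section completion_of_squares.
Context (R : realType) (n l m : nat) (gamma : R).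
Context (A C : 'M[R]_n) (B D : 'M[R]_(n, l)) (Phi : 'M[R]_(m, n)).
Context (P Q : 'M[R]_n).
Hypotheses (sP : P^T = P) (sQ : Q^T = Q).

Let L := A^T *m Q *m A + C^T *m P *m C - Phi^T *m Phi.
Let G := A^T *m Q *m B + C^T *m P *m D.
Let H := (gamma ^+ 2)%:M + B^T *m Q *m B + D^T *m P *m D.

Hypothesis pH : posdefmx H.

(** Serves the mean with the summed coefficients, and the deviation with [Q := P] and the plain
    ones. Since [H *m (invmx H *m G^T) = G^T], expanding the square reproduces the mixed term
    [2 x^T G v], and its excess [x^T G H^-1 G^T x] cancels. *)
Lemma completion_of_squares x v :
  bform Q (A *m x + B *m v) (A *m x + B *m v)
  + bform P (C *m x + D *m v) (C *m x + D *m v)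
  + gamma ^+ 2 * sqnorm v - sqnorm (Phi *m x)
  = bform (L - G *m invmx H *m G^T) x x
    + bform H (v + invmx H *m G^T *m x) (v + invmx H *m G^T *m x).
Proof.
have sH := proj1 pH; have uH := posdefmx_unit pH.
have siH : (invmx H)^T = invmx H by rewrite trmx_inv sH.
have -> : bform H (v + invmx H *m G^T *m x) (v + invmx H *m G^T *m x)
    = bform H v v + 2 * bform G x v + bform (G *m invmx H *m G^T) x x.
  have HM : H *m (invmx H *m G^T) = G^T by rewrite mulKVmx.
  rewrite !(bformDl, bformDr) (@bform_sym _ _ _ (_ *m x) v sH).
  rewrite bform_mulmx bform_mulmxr -mulmxA HM bform_tr.
  by rewrite trmx_mul trmxK siH; ring.
rewrite bformDm bformNm /L /G /H !(bformDm, bformNm) bform_scalar -sqnormE.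
rewrite (sqnormE (_ *m _)) bform_mulmx mulmx1 !(bformDl, bformDr).
rewrite (@bform_sym _ _ Q (B *m v) (A *m x) sQ).
rewrite (@bform_sym _ _ P (D *m v) (C *m x) sP) !bform_mulmx; ring.
Qed.

(** With zero input, the completed square writes this form as the [Q]-form plus the [P]-form, minus
    [sqnorm (Phi *m x)] and minus an [H]-square. *)
Lemma riccati_step_le0 :
  (forall x, bform P x x <= 0) -> (forall x, bform Q x x <= 0) ->
  forall x, bform (L - G *m invmx H *m G^T) x x <= 0.
Proof.
move=> P0 Q0 x; have := completion_of_squares x 0.
rewrite !mulmx0 !addr0 add0r sqnormE bform0l mulr0 addr0.
have := P0 (C *m x); have := Q0 (A *m x); have := sqnorm_ge0 (Phi *m x).
have := posdefmx_ge0 (invmx H *m G^T *m x) pH; lra.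
Qed.

(** The input is the completed square's argument minus a feedback term; coercivity of [H] bounds the
    former. The second bound is continuity of linear maps. One constant serves both, as
    [input_le_residual] expects. *)
Lemma stage_bounds : exists2 c : R, 0 <= c & forall x v,
  sqnorm v <= c * (sqnorm x
    + bform H (v + invmx H *m G^T *m x) (v + invmx H *m G^T *m x)) /\
  sqnorm (A *m x + B *m v) + sqnorm (C *m x + D *m v)
    <= c * (sqnorm x + sqnorm v).
Proof.
have [h h0 hH] := sqnorm_le_posdefmx pH.
have [f f0 fF] := sqnorm_mulmx_le (invmx H *m G^T).
have [a a0 aA] := sqnorm_affine_le A B; have [b b0 bC] := sqnorm_affine_le C D.
exists (2 * (h + f) + a + b) => [|x v].
  by rewrite !addr_ge0 ?mulr_ge0 ?addr_ge0.
have x0 := sqnorm_ge0 x; have v0 := sqnorm_ge0 v.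
split; last by have := aA x v; have := bC x v; nra.
set w := invmx H *m G^T *m x; set u := v + w.
have -> : v = u + (-1) *: w by rewrite scaleN1r addrK.
apply: le_trans (sqnormD_le _ _) _.
have -> : sqnorm (-1 *: w) = sqnorm w.
  by rewrite !sqnormE bformZl bformZr; ring.
have := hH u; have := fF x; rewrite -/w -/u.
have := posdefmx_ge0 u pH; set q := bform H u u => q0 wf uh.
have : 0 <= h * sqnorm x by rewrite mulr_ge0.
have : 0 <= f * q by rewrite mulr_ge0.
have : 0 <= (a + b) * (sqnorm x + q) by rewrite mulr_ge0 ?addr_ge0.
lra.
Qed.

End completion_of_squares.

(** Discrete Gronwall estimate, to be applied to the state energy [e], the input energy [s] and the
    residual [r]. The constant is fixed before the sequences: it depends on [K] and [c] only. *)
Lemma input_le_residual (R : realType) (K : nat) (c : nat -> R) :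
  (forall k, 0 <= c k) -> exists2 C : R, 0 < C &
  forall e s r : nat -> R, (forall k, (k <= K)%N -> 0 <= r k) -> e 0 = 0 ->
    (forall k, (k <= K)%N -> s k <= c k * (e k + r k)) ->
    (forall k, (k <= K)%N -> e k.+1 <= c k * (e k + s k)) ->
    \sum_(k < K.+1) s k <= C * \sum_(k < K.+1) r k.
Proof.
move=> c0.
pose dominated e s r := [/\ forall k, (k <= K)%N -> 0 <= r k, e 0 = 0,
    forall k, (k <= K)%N -> s k <= c k * (e k + r k)
  & forall k, (k <= K)%N -> e k.+1 <= c k * (e k + s k)].
(* The induction carries the current energy together with the partial sum of inputs, both measured
   against the full sum of [r], which does not change with [k]. *)
suff bnd k : (k <= K.+1)%N -> exists2 C : R, 0 <= C &
    forall e s r, dominated e s r -> e k <= C * \sum_(j < K.+1) r j /\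
      \sum_(j < k) s j <= C * \sum_(j < K.+1) r j.
  have [C C0 {}bnd] := bnd _ (leqnn _).
  (* Adding 1 makes the constant strictly positive, so that it can be inverted later. *)
  exists (C + 1) => [|e s r r0 e0 hs he]; first by rewrite ltr_wpDl.
  have [|_] := bnd e s r; first by split.
  move=> /le_trans; apply.
  rewrite ler_wpM2r ?lerDl// sumr_ge0// => j _; exact: r0 (ltn_ord j).
elim: k => [_|k IH kK].
  by exists 0 => // e s r [_ e0 _ _]; rewrite e0 big_ord0 mul0r.
have [C C0 bnd] := IH (ltnW kK).
pose C1 := c k * (C + 1).
have C10 : 0 <= C1 by rewrite mulr_ge0// addr_ge0.
exists (C + C1 + c k * (C + C1)) => [|e s r D].
  by rewrite !addr_ge0// mulr_ge0// addr_ge0.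
have [ek sk] := bnd e s r D; have [r0 _ hs he] := D.
set Rt := \sum_(j < K.+1) r j in ek sk *.
have rk : r k <= Rt.
  rewrite /Rt (bigD1 (Ordinal kK))//= lerDl sumr_ge0// => j _.
  by apply: r0; rewrite -ltnS.
have Rt0 : 0 <= Rt by apply: le_trans rk; exact: r0.
have s1 : s k <= C1 * Rt.
  apply: le_trans (hs k kK) _; rewrite -mulrA ler_wpM2l//; lra.
have e1 : e k.+1 <= c k * (C + C1) * Rt.
  apply: le_trans (he k kK) _; rewrite -mulrA ler_wpM2l//; lra.
have u1 : 0 <= c k * (C + C1) * Rt by rewrite !mulr_ge0// addr_ge0.
have u2 : 0 <= C1 * Rt by rewrite mulr_ge0.
have u3 : 0 <= C * Rt by rewrite mulr_ge0.
by rewrite big_ord_recr /=; split; lra.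
Qed.

(** * Real-valued expectation and products of independent variables *)

Section real_expectation.
Context (R : realType) (d : measure_display) (T : measurableType d).
Variable mu : probability T R.

Definition integ (f : T -> R) : Prop := mu.-integrable setT (EFin \o f).

(** Real values keep [ring] and [lra] available; [fine] sends infinite values to 0, a case that
    [integ] excludes. *)
Definition rexp (f : T -> R) : R := fine ('E_mu[f])%E.

Lemma integ_expectation f : integ f -> ('E_mu[f] = (rexp f)%:E)%E.
Proof.
by move=> fi; rewrite /rexp fineK// unlock; exact: integrable_fin_num.
Qed.

Lemma integ_cst c : integ (fun=> c).
Proof. by apply: finite_measure_integrable_cst. Qed.

Lemma integD f g : integ f -> integ g -> integ (fun w => f w + g w).
Proof.
move=> fi gi; apply: eq_integrable (integrableD measurableT fi gi) => //.
Qed.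

Lemma integZ c f : integ f -> integ (fun w => c * f w).
Proof.
by move=> fi; apply: eq_integrable (integrableZl measurableT c fi).
Qed.

Lemma integ_sum (I : Type) (s : seq I) (f : I -> T -> R) :
  (forall i, integ (f i)) -> integ (fun w => \sum_(i <- s) f i w).
Proof.
move=> fi; elim: s => [|i s IH].
  by rewrite (_ : (fun _ => _) = fun=> 0);
    [exact: integ_cst|apply/funext => w; rewrite big_nil].
rewrite (_ : (fun _ => _) = fun w => f i w + \sum_(i <- s) f i w).
  exact: integD.
by apply/funext => w; rewrite big_cons.
Qed.

Lemma integ_meas (f : T -> R) : integ f -> measurable_fun setT f.
Proof. by move=> /measurable_int /measurable_EFinP. Qed.

Lemma le_integ (f g : T -> R) : measurable_fun setT f -> integ g ->
  (forall w, `|f w| <= g w) -> integ f.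
Proof.
move=> mf gi fg; apply: le_integrable gi => //; first exact/measurable_EFinP.
by move=> w _ /=; rewrite lee_fin (le_trans (fg w))// ler_norm.
Qed.

Lemma rexp_cst c : rexp (fun=> c) = c.
Proof. by rewrite /rexp (_ : (fun=> c) = cst c)// expectation_cst. Qed.

Lemma rexpD f g : integ f -> integ g ->
  rexp (fun w => f w + g w) = rexp f + rexp g.
Proof.
move=> fi gi; apply: EFin_inj; rewrite EFinD -!integ_expectation//; last first.
  exact: integD.
by rewrite unlock integralD_EFin.
Qed.

Lemma rexpZ c f : integ f -> rexp (fun w => c * f w) = c * rexp f.
Proof.
move=> fi; apply: EFin_inj; rewrite EFinM -!integ_expectation//; last first.
  exact: integZ.
by rewrite unlock -integralZl.
Qed.

Lemma rexp_sum (I : Type) (s : seq I) (f : I -> T -> R) :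
  (forall i, integ (f i)) ->
  rexp (fun w => \sum_(i <- s) f i w) = \sum_(i <- s) rexp (f i).
Proof.
move=> fi; elim: s => [|i s IH].
  rewrite big_nil -[RHS]rexp_cst; congr rexp.
  by apply/funext => w; rewrite big_nil.
rewrite big_cons -IH -rexpD//; last exact: integ_sum.
by congr rexp; apply/funext => w; rewrite big_cons.
Qed.

Lemma rexp_ge0 f : (forall w, 0 <= f w) -> 0 <= rexp f.
Proof. by move=> f0; rewrite fine_ge0// expectation_ge0. Qed.

Lemma rexp_le f g : integ f -> integ g -> (forall w, f w <= g w) ->
  rexp f <= rexp g.
Proof.
move=> fi gi fg; rewrite -lee_fin -!integ_expectation// unlock.
by apply: le_integral => // w _; rewrite lee_fin.
Qed.

(** By independence the law of the pair agrees with the product of the laws on rectangles, hence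
    everywhere; Fubini then factors the integral of [z.1 * z.2]. *)
Lemma rexp_indep (X Y : T -> R) : integ X -> integ Y ->
  (forall U V : set R, measurable U -> measurable V ->
    mu (X @^-1` U `&` Y @^-1` V) = (mu (X @^-1` U) * mu (Y @^-1` V))%E) ->
  integ (fun w => X w * Y w) /\ rexp (fun w => X w * Y w) = rexp X * rexp Y.
Proof.
move=> iX iY XY; have mX := integ_meas iX; have mY := integ_meas iY.
pose X' : {RV mu >-> R} := HB.pack X (isMeasurableFun.Build _ _ _ _ _ mX).
pose Y' : {RV mu >-> R} := HB.pack Y (isMeasurableFun.Build _ _ _ _ _ mY).
have mXY : measurable_fun setT (fun w => (X w, Y w)).
  exact: measurable_fun_pair.
pose Z' : {mfun T >-> (R * R)%type} :=
  HB.pack (fun w => (X w, Y w)) (isMeasurableFun.Build _ _ _ _ _ mXY).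
have law A : measurable A ->
    (distribution mu X' \x distribution mu Y')%E A = distribution mu Z' A.
  apply: product_measure_unique => U V mU mV /=.
  exact: XY.
pose g (z : R * R) : \bar R := (z.1 * z.2)%:E.
have mg : measurable_fun setT g.
  by apply/measurable_EFinP; apply: measurable_funM.
have iX' : (distribution mu X').-integrable setT EFin.
  exact: integrable_pushforward.
have iY' : (distribution mu Y').-integrable setT EFin.
  exact: integrable_pushforward.
have EX' : (\int[distribution mu X']_x x%:E = (rexp X)%:E)%E.
  by rewrite -integ_expectation// unlock; exact: integral_pushforward.
have EY' : (\int[distribution mu Y']_x x%:E = (rexp Y)%:E)%E.
  by rewrite -integ_expectation// unlock; exact: integral_pushforward.
have ig : (distribution mu X' \x distribution mu Y')%E.-integrable setT g.
  (* Tonelli: the iterated integral of [|x y|] is the product of the two absolute first moments,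
     both finite. *)
  apply/integrable12ltyP => //.
  have -> : (fun x => (\int[distribution mu Y']_y `|g (x, y)|)%E) =
      (fun x => `|x%:E| * \int[distribution mu Y']_y `|y%:E|)%E.
    apply/funext => x; rewrite -ge0_integralZl//.
      by apply: eq_integral => y _; rewrite /g EFinM abseM.
    by apply: measurableT_comp => //; exact: measurable_int iY'.
  have /integrableP[_ fX] := iX'; have /integrableP[mE fY] := iY'.
  rewrite ge0_integralZr//; last by apply: integral_ge0.
    by apply: lte_mul_pinfty => //; [exact: integral_ge0
      |rewrite ge0_fin_numE//; exact: integral_ge0].
  by apply: measurableT_comp.
(* Integrability under the product law is carried back to [T] through the law of the pair. *)
have iXY : integ (fun w => X w * Y w).
  apply/integrableP; split; first by apply/measurable_EFinP/measurable_funM.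
  have /integrableP[_] := ig.
  rewrite (eq_measure_integral (distribution mu Z')); last first.
    by move=> A mA _; exact: law.
  rewrite ge0_integral_distribution//.
  by apply: measurableT_comp.
split=> //; apply: EFin_inj; rewrite -integ_expectation// unlock.
transitivity (\int[distribution mu Z']_z g z)%E.
  by rewrite integral_pushforward.
rewrite (eq_measure_integral (distribution mu X' \x distribution mu Y')%E);
  last first.
  by move=> A mA _; exact/esym/law.
rewrite -integral12_prod_meas1// /fubini_F /g.
under eq_integral => x _.
  under eq_integral => y _ do rewrite EFinM.
  rewrite integralZl// EY'.
  over.
by rewrite integralZr// EX' EFinM.
Qed.

End real_expectation.

(** * Adapted variables and moments against the noise *)

Section noise_moments.
Context (R : realType) (d : measure_display) (T : measurableType d).
Variables (mu : probability T R) (omega : nat -> {RV mu >-> R}).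

Let gens k : set (set T) :=
  \bigcup_(j in [set j | (j < k)%N])
    preimage_set_system setT (omega j) measurable.

Definition adapted k (f : T -> R) : Prop :=
  forall U : set R, measurable U -> past omega k (f @^-1` U).

(** Opens the closure properties of measurable functions to the sigma-algebra [past omega k]. *)
Lemma adaptedP k f :
  adapted k f <-> measurable_fun setT (f : g_sigma_algebraType (gens k) -> R).
Proof.
by split=> [af _ U mU|mf U mU]; [rewrite setTI; exact: af|
  rewrite -[X in past _ _ X]setTI; exact: mf].
Qed.

Lemma past_measurable k : past omega k `<=` measurable.
Proof.
apply: (smallest_sub (@sigma_algebra_measurable _ T)) => _ [j _ [U mU <-]].
exact: measurable_funP.
Qed.

Lemma past_le k j : (k <= j)%N -> past omega k `<=` past omega j.
Proof.
move=> kj; apply: sub_sigma_algebra2 => A [i /= ik Ai].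
by exists i => //=; exact: leq_trans ik kj.
Qed.

Lemma adapted_measurable k f : adapted k f -> measurable_fun setT f.
Proof.
by move=> af _ U mU; rewrite setTI; exact: past_measurable (af U mU).
Qed.

Lemma adapted_le k j f : (k <= j)%N -> adapted k f -> adapted j f.
Proof. by move=> kj af U mU; exact: past_le kj _ (af U mU). Qed.

Lemma adapted_cst k c : adapted k (fun=> c).
Proof. by apply/adaptedP; exact: measurable_cst. Qed.

Lemma adaptedD k f g : adapted k f -> adapted k g ->
  adapted k (fun w => f w + g w).
Proof. by move=> /adaptedP mf /adaptedP mg; exact/adaptedP/measurable_funD. Qed.

Lemma adaptedM k f g : adapted k f -> adapted k g ->
  adapted k (fun w => f w * g w).
Proof. by move=> /adaptedP mf /adaptedP mg; exact/adaptedP/measurable_funM. Qed.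

(** [past omega k] is generated by the noise strictly before time [k], hence the shift. *)
Lemma adapted_noise k : adapted k.+1 (omega k).
Proof.
move=> U mU; apply: sub_sigma_algebra; exists k => //=.
by exists U => //; rewrite setTI.
Qed.

Definition sqint k (f : T -> R) : Prop :=
  adapted k f /\ integ mu (fun w => f w ^+ 2).

(** Domination by [|f g| <= f^2 + g^2]. *)
Lemma sqint_mul k f g : sqint k f -> sqint k g -> integ mu (fun w => f w * g w).
Proof.
move=> [af f2] [ag g2]; apply: le_integ (integD f2 g2) _.
  by apply: (@adapted_measurable k); exact: adaptedM.
move=> w; rewrite ler_norml; apply/andP.
have := sqr_ge0 (f w + g w); have := sqr_ge0 (f w - g w).
have := sqr_ge0 (f w); have := sqr_ge0 (g w); split; nra.
Qed.

Lemma sqint_cst k c : sqint k (fun=> c).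
Proof. by split; [exact: adapted_cst|exact: integ_cst]. Qed.

Lemma sqint_integ k f : sqint k f -> integ mu f.
Proof.
move=> fi; have := sqint_mul fi (sqint_cst k 1).
by congr integ; apply/funext => w; rewrite mulr1.
Qed.

Lemma sqintD k f g : sqint k f -> sqint k g -> sqint k (fun w => f w + g w).
Proof.
move=> fi gi; split; first by apply: adaptedD; [case: fi|case: gi].
rewrite (_ : (fun _ => _) =
  fun w => f w ^+ 2 + (2 * (f w * g w) + g w ^+ 2)); last first.
  by apply/funext => w; ring.
apply: integD; first by case: fi.
by apply: integD; [exact/integZ/(sqint_mul fi gi)|case: gi].
Qed.

Lemma sqintZ k c f : sqint k f -> sqint k (fun w => c * f w).
Proof.
move=> [af f2]; split; first by apply: adaptedM => //; exact: adapted_cst.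
have := integZ (c ^+ 2) f2; congr integ; apply/funext => w; ring.
Qed.

Lemma sqint_sum k (I : Type) (s : seq I) (f : I -> T -> R) :
  (forall i, sqint k (f i)) -> sqint k (fun w => \sum_(i <- s) f i w).
Proof.
move=> fi; elim: s => [|i s IH].
  by rewrite (_ : (fun _ => _) = fun=> 0);
    [exact: sqint_cst|apply/funext => w; rewrite big_nil].
rewrite (_ : (fun _ => _) = fun w => f i w + \sum_(i <- s) f i w).
  exact: sqintD.
by apply/funext => w; rewrite big_cons.
Qed.

Lemma sqint_le k j f : (k <= j)%N -> sqint k f -> sqint j f.
Proof. by move=> kj [af f2]; split=> //; exact: adapted_le af. Qed.

Variable K : nat.
Hypothesis omega_noise : mf_noise K omega.

(** The second moment equals 1 in the extended reals and the integrand is nonnegative, so the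
    integral of its absolute value is finite. *)
Lemma noise_sq_integ k : (k <= K)%N -> integ mu (fun w => omega k w ^+ 2).
Proof.
move=> kK; have [_ /(_ k k kK kK) + _] := omega_noise.
rewrite eqxx unlock => Ek.
have m2 : measurable_fun setT (fun w => omega k w ^+ 2).
  by apply: measurable_funX; exact: measurable_funP.
apply/integrableP; split; first exact/measurable_EFinP.
rewrite (_ : (\int[mu]_x `|(EFin \o (fun w => (omega k w ^+ 2)%R)) x|)%E =
  1%:E).
  by rewrite ltry.
rewrite -[RHS]Ek; apply: eq_integral => w _ /=.
by rewrite ger0_norm ?sqr_ge0// expr2.
Qed.

Lemma rexp_noise_sq k : (k <= K)%N -> rexp mu (fun w => omega k w ^+ 2) = 1.
Proof.
move=> kK; have [_ /(_ k k kK kK) + _] := omega_noise.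
rewrite eqxx /rexp => Ek.
by rewrite (_ : (fun _ => _) = fun w => omega k w * omega k w) ?Ek.
Qed.

Lemma noise_sqint k : (k <= K)%N -> sqint k.+1 (omega k).
Proof. by move=> kK; split; [exact: adapted_noise|exact: noise_sq_integ]. Qed.

(** [omega k] is independent of the past, to which [f] is adapted, so the expectation factors; the
    factor of [omega k] is 0. *)
Lemma noise_mul k f : (k <= K)%N -> adapted k f -> integ mu f ->
  integ mu (fun w => omega k w * f w) /\ rexp mu (fun w => omega k w * f w) = 0.
Proof.
move=> kK af fi; have [m0 _ ind] := omega_noise.
have [|||? ->] := @rexp_indep _ _ _ mu (omega k) f.
- exact: sqint_integ (noise_sqint kK).
- exact: fi.
- by move=> U V mU mV; apply: ind => //; exact: af.
by split=> //; rewrite {1}/rexp m0// mul0r.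
Qed.

(** Squaring keeps independence, since a preimage under [omega k ^+ 2] is also one under [omega k];
    the factored second moment is 1. *)
Lemma noise_sq_mul k f : (k <= K)%N -> adapted k f -> integ mu f ->
  integ mu (fun w => omega k w ^+ 2 * f w) /\
  rexp mu (fun w => omega k w ^+ 2 * f w) = rexp mu f.
Proof.
move=> kK af fi; have [_ _ ind] := omega_noise.
have [|||? ->] := @rexp_indep _ _ _ mu (fun w => omega k w ^+ 2) f.
- exact: noise_sq_integ.
- exact: fi.
- move=> U V mU mV.
  rewrite (_ : _ @^-1` U = omega k @^-1` ((fun x : R => x ^+ 2) @^-1` U))//.
  apply: ind => //; last exact: af.
  rewrite -[X in measurable X]setTI.
  by have : measurable_fun setT (fun x : R => x ^+ 2) by []; exact.
by rewrite rexp_noise_sq// mul1r.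
Qed.

(** A product of square-integrable variables is in general only integrable; independence of
    [omega k ^+ 2] and [f ^+ 2] gives the square as well. *)
Lemma sqint_noise k f : (k <= K)%N -> sqint k f ->
  sqint k.+1 (fun w => omega k w * f w).
Proof.
move=> kK [af f2]; split.
  by apply: adaptedM; [exact: adapted_noise|exact: adapted_le af].
have /(noise_sq_mul kK)/(_ f2)[] : adapted k (fun w => f w ^+ 2).
  exact: adaptedM.
by move=> + _; congr integ; apply/funext => w; rewrite exprMn.
Qed.

(** * Random vectors and expected quadratic forms *)

Definition vsqint k p (X : T -> 'cV[R]_p) : Prop :=
  forall i, sqint k (fun w => X w i 0).

Lemma vsqint_cst k p (c : 'cV[R]_p) : vsqint k (fun=> c).
Proof. by move=> i; exact: sqint_cst. Qed.

Lemma vsqintD k p (X Y : T -> 'cV[R]_p) : vsqint k X -> vsqint k Y ->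
  vsqint k (fun w => X w + Y w).
Proof.
move=> iX iY i; have := sqintD (iX i) (iY i).
by congr sqint; apply/funext => w; rewrite mxE.
Qed.

Lemma vsqint_mulmx k p q (A : 'M[R]_(q, p)) (X : T -> 'cV[R]_p) :
  vsqint k X -> vsqint k (fun w => A *m X w).
Proof.
move=> iX i.
have : sqint k (fun w => \sum_j A i j * X w j 0).
  by apply: sqint_sum => j; exact: sqintZ.
by congr sqint; apply/funext => w; rewrite mxE.
Qed.

Lemma vsqint_noise k p (X : T -> 'cV[R]_p) : (k <= K)%N -> vsqint k X ->
  vsqint k.+1 (fun w => omega k w *: X w).
Proof.
move=> kK iX i; have := sqint_noise kK (iX i).
by congr sqint; apply/funext => w; rewrite mxE.
Qed.

Lemma vsqint_le k j p (X : T -> 'cV[R]_p) : (k <= j)%N ->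
  vsqint k X -> vsqint j X.
Proof. by move=> kj iX i; exact: sqint_le (iX i). Qed.

Lemma bform_adapted k p q (P : 'M[R]_(p, q)) X Y : vsqint k X -> vsqint k Y ->
  adapted k (fun w => bform P (X w) (Y w)).
Proof.
move=> iX iY; under eq_fun do rewrite bformE.
apply/adaptedP; apply: measurable_sum => i; apply: measurable_sum => j.
apply/adaptedP; apply: adaptedM; first exact: adapted_cst.
by apply: adaptedM; [case: (iX i)|case: (iY j)].
Qed.

Lemma bform_integ k p q (P : 'M[R]_(p, q)) X Y : vsqint k X -> vsqint k Y ->
  integ mu (fun w => bform P (X w) (Y w)).
Proof.
move=> iX iY; under eq_fun do rewrite bformE.
apply: integ_sum => i; apply: integ_sum => j; apply: integZ.
exact: sqint_mul (iX i) (iY j).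
Qed.

Lemma vexp_cst p (c : 'cV[R]_p) : vexp mu (fun=> c) = c.
Proof. by apply/colP => i; rewrite mxE; exact: rexp_cst. Qed.

Lemma vexpD k p (X Y : T -> 'cV[R]_p) : vsqint k X -> vsqint k Y ->
  vexp mu (fun w => X w + Y w) = vexp mu X + vexp mu Y.
Proof.
move=> iX iY; apply/colP => i; rewrite !mxE.
rewrite -[RHS](rexpD (sqint_integ (iX i)) (sqint_integ (iY i))).
by congr (rexp mu _); apply/funext => w; rewrite mxE.
Qed.

Lemma vexp_mulmx k p q (A : 'M[R]_(q, p)) (X : T -> 'cV[R]_p) :
  vsqint k X -> vexp mu (fun w => A *m X w) = A *m vexp mu X.
Proof.
move=> iX; apply/colP => i; rewrite !mxE.
under [RHS]eq_bigr => j _ do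
  rewrite mxE -[_ * _](rexpZ (A i j) (sqint_integ (iX j))).
rewrite -rexp_sum; last by move=> j; exact/integZ/(sqint_integ (iX j)).
by congr (rexp mu _); apply/funext => w; rewrite mxE.
Qed.

Lemma vexp_noise k p (X : T -> 'cV[R]_p) : (k <= K)%N -> vsqint k X ->
  vexp mu (fun w => omega k w *: X w) = 0.
Proof.
move=> kK iX; apply/colP => i; rewrite !mxE.
have [_ <-] := noise_mul kK (proj1 (iX i)) (sqint_integ (iX i)).
by congr (rexp mu _); apply/funext => w; rewrite mxE.
Qed.

Lemma vexp_center k p (X : T -> 'cV[R]_p) : vsqint k X ->
  vsqint k (fun w => X w - vexp mu X) /\
  vexp mu (fun w => X w - vexp mu X) = 0.
Proof.
move=> iX; split; first exact: vsqintD (vsqint_cst _ _).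
by rewrite (vexpD iX (vsqint_cst _ _)) vexp_cst subrr.
Qed.

Lemma rexp_bform_cstr k p q (P : 'M[R]_(p, q)) X c : vsqint k X ->
  rexp mu (fun w => bform P (X w) c) = bform P (vexp mu X) c.
Proof.
move=> iX; rewrite bformE; under eq_fun do rewrite bformE exchange_big /=.
rewrite exchange_big rexp_sum => [|j]; last first.
  apply: integ_sum => i; apply: integZ.
  exact: sqint_mul (iX i) (sqint_cst k _).
apply: eq_bigr => j _; rewrite rexp_sum => [|i]; last first.
  by apply: integZ; exact: sqint_mul (iX i) (sqint_cst k _).
apply: eq_bigr => i _; rewrite mxE.
rewrite (_ : (fun _ => _) = fun w => P i j * c j 0 * X w i 0); last first.
  by apply/funext => w; ring.
by rewrite (rexpZ _ (sqint_integ (iX i))) mulrAC -mulrA.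
Qed.

Lemma rexp_bform_cstl k p q (P : 'M[R]_(p, q)) X c : vsqint k X ->
  rexp mu (fun w => bform P c (X w)) = bform P c (vexp mu X).
Proof.
move=> iX; rewrite -bform_tr -(rexp_bform_cstr _ _ iX).
by congr (rexp mu _); apply/funext => w; rewrite bform_tr.
Qed.

(** The cross terms pair a centred vector with a constant and average to 0. *)
Lemma rexp_bform_addcst k p (P : 'M[R]_p) X c : vsqint k X -> vexp mu X = 0 ->
  rexp mu (fun w => bform P (X w + c) (X w + c)) =
  rexp mu (fun w => bform P (X w) (X w)) + bform P c c.
Proof.
move=> iX X0; have ic := @vsqint_cst k p c.
have XX := bform_integ P iX iX; have Xc := bform_integ P iX ic.
have cX := bform_integ P ic iX.
(* The vanishing cross terms are written in, so that the right side collapses into one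
   expectation. *)
have -> : rexp mu (fun w => bform P (X w) (X w)) + bform P c c =
    rexp mu (fun w => bform P (X w) (X w))
    + (rexp mu (fun w => bform P (X w) c)
       + (rexp mu (fun w => bform P c (X w)) + rexp mu (fun=> bform P c c))).
  rewrite (rexp_bform_cstl _ _ iX) (rexp_bform_cstr _ _ iX) rexp_cst.
  by rewrite X0 bform0l bform0r !add0r.
have cc : integ mu (fun=> bform P c c) by exact: integ_cst.
rewrite -!rexpD//; do ?by repeat apply: integD.
by congr (rexp mu _); apply/funext => w; rewrite bformDl !bformDr; ring.
Qed.

(** Cross terms carry one factor [omega k] and average to 0; the last term carries [omega k ^+ 2],
    of mean 1 and independent of [Y]. *)
Lemma rexp_bform_addnoise k p (P : 'M[R]_p) X Y : (k <= K)%N ->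
  vsqint k X -> vsqint k Y ->
  rexp mu (fun w => bform P (X w + omega k w *: Y w) (X w + omega k w *: Y w)) =
  rexp mu (fun w => bform P (X w) (X w))
  + rexp mu (fun w => bform P (Y w) (Y w)).
Proof.
move=> kK iX iY.
have XX := bform_integ P iX iX.
have [iXY XY] := noise_mul kK (bform_adapted P iX iY) (bform_integ P iX iY).
have [iYX YX] := noise_mul kK (bform_adapted P iY iX) (bform_integ P iY iX).
have [iYY <-] := noise_sq_mul kK (bform_adapted P iY iY) (bform_integ P iY iY).
rewrite -[X in _ = X + _]addr0 -XY -[X in _ = X + _]addr0 -YX.
rewrite -!rexpD//; do ?by repeat apply: integD.
congr (rexp mu _); apply/funext => w.
by rewrite bformDl !bformDr !bformZl !bformZr; ring.
Qed.

End noise_moments.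

(** * The mean-field system: mean and deviation dynamics *)

Section mean_field.
Context (R : realType) (d : measure_display) (T : measurableType d).
Context (mu : probability T R) (n l m K : nat) (gamma : R).
Context (S : mf_system R n l m) (omega : nat -> {RV mu >-> R}).
Hypothesis omega_noise : mf_noise K omega.

Section trajectory.
Variable nu : nat -> T -> 'cV[R]_l.
Hypothesis nu_l2 : l2w K omega nu.

(** [xm] and [num] are the means of state and input, [y] and [eta] the deviations from them. *)
Let x k := mf_state S omega 0 nu k.
Let xm k := vexp mu (x k).
Let num k := vexp mu (nu k).
Let y k w := x k w - xm k.
Let eta k w := nu k w - num k.

Lemma input_vsqint k : (k <= K)%N -> vsqint omega k (nu k).
Proof.
move=> kK i; have [ak nk] := nu_l2 kK; split; first by move=> U mU; exact: ak.
apply: le_integ nk _.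
  apply: measurable_funX; apply: (@adapted_measurable _ _ _ _ omega k).
  by move=> U mU; exact: ak.
move=> w; rewrite ger0_norm ?sqr_ge0// /sqnorm (bigD1 i)//= lerDl.
by apply: sumr_ge0 => j _; exact: sqr_ge0.
Qed.

(** Each step multiplies by [omega k] with [k <= K] and passes from [past omega k] to
    [past omega k.+1], so the range reaches [K.+1]. *)
Lemma state_vsqint k : (k <= K.+1)%N -> vsqint omega k (x k).
Proof.
elim: k => [_|k IH kK]; first exact: vsqint_cst.
have {}IH := IH (ltnW kK); have ik := input_vsqint kK.
have aff (E Et : 'M[R]_n) (F Ft : 'M[R]_(n, l)) :
    vsqint omega k (fun w =>
      E *m x k w + Et *m xm k + F *m nu k w + Ft *m num k).
  apply: vsqintD; last exact: vsqint_cst.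
  apply: vsqintD; last exact: vsqint_mulmx.
  by apply: vsqintD; [exact: vsqint_mulmx|exact: vsqint_cst].
apply: vsqintD; first exact: vsqint_le (aff _ _ _ _).
exact: (vsqint_noise omega_noise).
Qed.

Let y_vsqint k : (k <= K.+1)%N -> vsqint omega k (y k).
Proof. by move=> kK; have [] := vexp_center (state_vsqint kK). Qed.

Let eta_vsqint k : (k <= K)%N -> vsqint omega k (eta k).
Proof. by move=> kK; have [] := vexp_center (input_vsqint kK). Qed.

Let aff_vsqint k p (E : 'M[R]_(p, n)) (F : 'M[R]_(p, l)) : (k <= K)%N ->
  vsqint omega k (fun w => E *m y k w + F *m eta k w).
Proof.
move=> kK; apply: vsqintD; apply: vsqint_mulmx; last exact: eta_vsqint.
exact: y_vsqint (leqW kK).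
Qed.

Let aff_vexp0 k p (E : 'M[R]_(p, n)) (F : 'M[R]_(p, l)) : (k <= K)%N ->
  vexp mu (fun w => E *m y k w + F *m eta k w) = 0.
Proof.
move=> kK; have iy := y_vsqint (leqW kK); have ie := eta_vsqint kK.
rewrite (vexpD (vsqint_mulmx _ iy) (vsqint_mulmx _ ie)).
rewrite (vexp_mulmx _ iy) (vexp_mulmx _ ie).
have [_ ->] := vexp_center (state_vsqint (leqW kK)).
have [_ ->] := vexp_center (input_vsqint kK).
by rewrite !mulmx0 addr0.
Qed.

(** Substituting state and input as deviation plus mean leaves the plain coefficients on the
    deviations and the summed ones on the means. *)
Lemma state_step k w :
  x k.+1 w = (cA S k *m y k w + cB S k *m eta k w
    + (sA S k *m xm k + sB S k *m num k))
    + omega k w *: (cC S k *m y k w + cD S k *m eta k w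
      + (sC S k *m xm k + sD S k *m num k)).
Proof.
rewrite /x /= -/(x k) -/(xm k) -/(num k) /y /eta /sA /sB /sC /sD.
rewrite !mulmxBr !mulmxDl.
by apply/colP => i; rewrite !mxE; ring.
Qed.

Lemma mean_step k : (k <= K)%N ->
  xm k.+1 = sA S k *m xm k + sB S k *m num k.
Proof.
move=> kK; have ik := aff_vsqint (cA S k) (cB S k) kK.
have iN := vsqintD (aff_vsqint (cC S k) (cD S k) kK)
  (vsqint_cst omega k (sC S k *m xm k + sD S k *m num k)).
rewrite /xm (funext (state_step k)).
rewrite (@vexpD _ _ _ _ omega k.+1); last 2 first.
- exact: vsqint_le (leqnSn k) (vsqintD ik (vsqint_cst _ _ _)).
- exact: (vsqint_noise omega_noise).
rewrite (vexp_noise omega_noise)// addr0.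
by rewrite (vexpD ik (vsqint_cst _ _ _)) vexp_cst aff_vexp0// add0r.
Qed.

(** The drift of the mean cancels, so the mean reaches the deviation only through the noise. Hence
    [P] meets [sC] and [sD] in the equation for [Q]. *)
Lemma deviation_step k w : (k <= K)%N ->
  y k.+1 w = cA S k *m y k w + cB S k *m eta k w
    + omega k w *: (cC S k *m y k w + cD S k *m eta k w
      + (sC S k *m xm k + sD S k *m num k)).
Proof. by move=> kK; rewrite {1}/y mean_step// state_step addrAC addrK. Qed.

(** Drift and noise term are uncorrelated; inside the noise coefficient the centred part is
    uncorrelated with the mean part. *)
Lemma covariance_step k (P : 'M[R]_n) : (k <= K)%N ->
  rexp mu (fun w => bform P (y k.+1 w) (y k.+1 w)) =
  rexp mu (fun w => bform P (cA S k *m y k w + cB S k *m eta k w)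
                            (cA S k *m y k w + cB S k *m eta k w))
  + rexp mu (fun w => bform P (cC S k *m y k w + cD S k *m eta k w)
                              (cC S k *m y k w + cD S k *m eta k w))
  + bform P (sC S k *m xm k + sD S k *m num k)
            (sC S k *m xm k + sD S k *m num k).
Proof.
move=> kK; have ik := aff_vsqint (cA S k) (cB S k) kK.
have iN := aff_vsqint (cC S k) (cD S k) kK.
under eq_fun do rewrite deviation_step//.
rewrite (rexp_bform_addnoise omega_noise)//; last first.
  by apply: vsqintD => //; exact: vsqint_cst.
by rewrite (rexp_bform_addcst _ _ iN) ?addrA// aff_vexp0.
Qed.

Lemma rexp_sqnorm_affine k p (E : 'M[R]_(p, n)) (F : 'M[R]_(p, l)) :
  (k <= K)%N ->
  rexp mu (fun w => sqnorm (E *m x k w + F *m nu k w)) =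
  rexp mu (fun w => sqnorm (E *m y k w + F *m eta k w))
  + sqnorm (E *m xm k + F *m num k).
Proof.
move=> kK; under [X in _ = rexp _ X + _]eq_fun do rewrite sqnormE.
rewrite sqnormE -(rexp_bform_addcst _ _ (aff_vsqint E F kK)) ?aff_vexp0//.
congr (rexp mu _); apply/funext => w; rewrite sqnormE.
suff -> : E *m x k w + F *m nu k w =
  E *m y k w + F *m eta k w + (E *m xm k + F *m num k) by [].
by rewrite /y /eta !mulmxBr addrACA !subrK.
Qed.

(** Energies stay split into deviation and mean, which the equations for [P] and [Q] treat
    separately; [rexp_input] and [rexp_output] identify them with second moments. *)
Definition input_energy k :=
  rexp mu (fun w => sqnorm (eta k w)) + sqnorm (num k).
Definition state_energy k :=
  rexp mu (fun w => sqnorm (y k w)) + sqnorm (xm k).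
Definition output_energy k :=
  rexp mu (fun w => sqnorm (cPhi S k *m y k w)) + sqnorm (cPhi S k *m xm k).

Lemma rexp_input k : (k <= K)%N ->
  rexp mu (fun w => sqnorm (nu k w)) = input_energy k.
Proof.
move=> kK; have aE (u : 'cV[R]_n) (v : 'cV[R]_l) : 0 *m u + 1%:M *m v = v.
  by rewrite mul0mx mul1mx add0r.
have := rexp_sqnorm_affine 0 1%:M kK; rewrite aE.
by under eq_fun do rewrite aE; under [in X in _ = X]eq_fun do rewrite aE.
Qed.

Lemma rexp_output k : (k <= K)%N ->
  rexp mu (fun w => sqnorm (mf_output S omega 0 nu k w)) = output_energy k.
Proof.
move=> kK; have aE (u : 'cV[R]_n) (v : 'cV[R]_l) :
    cPhi S k *m u + 0 *m v = cPhi S k *m u by rewrite mul0mx addr0.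
have := rexp_sqnorm_affine (cPhi S k) 0 kK; rewrite aE.
by under eq_fun do rewrite aE; under [in X in _ = X]eq_fun do rewrite aE.
Qed.

Let sqnorm_integ k p (X : T -> 'cV[R]_p) : vsqint omega k X ->
  integ mu (fun w => sqnorm (X w)).
Proof.
by move=> iX; under eq_fun do rewrite sqnormE; exact: (bform_integ _ iX iX).
Qed.

Lemma input_integ k : (k <= K)%N -> integ mu (fun w => sqnorm (nu k w)).
Proof. by move=> kK; exact: sqnorm_integ (input_vsqint kK). Qed.

Lemma output_integ k : (k <= K)%N ->
  integ mu (fun w => sqnorm (mf_output S omega 0 nu k w)).
Proof.
by move=> kK; exact: sqnorm_integ (vsqint_mulmx _ (state_vsqint (leqW kK))).
Qed.

(** * Dissipation identity and energy estimates along a trajectory *)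

Variables P Q : nat -> 'M[R]_n.
Hypothesis PQ : backward_solution S gamma K P Q.

(** [M] and [Mt] are the gains of the completed squares: the residual vanishes under the feedback
    [eta = - M y], [num = - Mt xm]. *)
Let H k := Hop S gamma k (P k.+1).
Let M k := invmx (H k) *m (Gop S k (P k.+1))^T.
Let Ht k := Htop S gamma k (P k.+1) (Q k.+1).
Let Mt k := invmx (Ht k) *m (Gtop S k (P k.+1) (Q k.+1))^T.

Definition residual k :=
  rexp mu (fun w => bform (H k) (eta k w + M k *m y k w)
                                (eta k w + M k *m y k w))
  + bform (Ht k) (num k + Mt k *m xm k) (num k + Mt k *m xm k).

(** The storage function of dissipativity theory; it vanishes at times 0 and [K.+1]. *)
Definition storage k :=
  rexp mu (fun w => bform (P k) (y k w) (y k w)) + bform (Q k) (xm k) (xm k).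

Let res_vsqint k : (k <= K)%N ->
  vsqint omega k (fun w => eta k w + M k *m y k w).
Proof.
move=> kK; apply: vsqintD; first exact: eta_vsqint.
exact/vsqint_mulmx/y_vsqint/leqW.
Qed.

Lemma residual_ge0 k : (k <= K)%N -> 0 <= residual k.
Proof.
move=> kK; have [_ _ /(_ k kK)[_ _ pH pHt]] := PQ.
by rewrite addr_ge0 ?posdefmx_ge0// rexp_ge0// => w; exact: posdefmx_ge0.
Qed.

(** Squares are completed at the means with the equation for [Q], and pointwise in [w] with the
    equation for [P]. The [P]-form of the mean noise coefficient, from [covariance_step], belongs to
    the balance of the means. *)
Lemma storage_step k : (k <= K)%N ->
  storage k.+1 + gamma ^+ 2 * input_energy k =
  storage k + residual k + output_energy k.
Proof.
move=> kK; have [symPQ _ /(_ k kK)[Pk Qk pH pHt]] := PQ.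
have [sP sQ] := symPQ k.+1 kK.
have iy := y_vsqint (leqW kK); have ie := eta_vsqint kK.
have := completion_of_squares (sA S k) (sC S k) (cPhi S k) sP sQ pHt
  (xm k) (num k).
rewrite -/(Gtop S k (P k.+1) (Q k.+1)) -/(Htop S gamma k (P k.+1) (Q k.+1)).
rewrite -/(Ltop S k (P k.+1) (Q k.+1)) -Qk -/(Ht k) -/(Mt k) => mean_eq.
suff dev_eq :
  rexp mu (fun w => bform (P k.+1) (cA S k *m y k w + cB S k *m eta k w)
                                   (cA S k *m y k w + cB S k *m eta k w))
  + rexp mu (fun w => bform (P k.+1) (cC S k *m y k w + cD S k *m eta k w)
                                     (cC S k *m y k w + cD S k *m eta k w))
  + gamma ^+ 2 * rexp mu (fun w => sqnorm (eta k w)) =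
  rexp mu (fun w => bform (P k) (y k w) (y k w))
  + rexp mu (fun w => bform (H k) (eta k w + M k *m y k w)
                                  (eta k w + M k *m y k w))
  + rexp mu (fun w => sqnorm (cPhi S k *m y k w)).
  rewrite /storage covariance_step// mean_step//.
  rewrite /residual /input_energy /output_energy; lra.
have i1 := bform_integ (P k.+1) (aff_vsqint (cA S k) (cB S k) kK)
  (aff_vsqint (cA S k) (cB S k) kK).
have i2 := bform_integ (P k.+1) (aff_vsqint (cC S k) (cD S k) kK)
  (aff_vsqint (cC S k) (cD S k) kK).
have i3 := sqnorm_integ ie.
have i4 := bform_integ (P k) iy iy.
have i5 := bform_integ (H k) (res_vsqint kK) (res_vsqint kK).
have i6 := sqnorm_integ (vsqint_mulmx (cPhi S k) iy).
(* Each side becomes a single expectation, so the identity can be checked pointwise. *)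
rewrite -(rexpZ _ i3) -!rexpD//;
  do ?by repeat first [exact: integZ|apply: integD].
congr (rexp mu _); apply/funext => w.
have := completion_of_squares (cA S k) (cC S k) (cPhi S k) sP sP pH
  (y k w) (eta k w).
rewrite -/(Gop S k (P k.+1)) -/(Hop S gamma k (P k.+1)).
rewrite -/(Lop S k (P k.+1)) -Pk -/(H k) -/(M k); lra.
Qed.

Lemma dissipation :
  \sum_(k < K.+1) output_energy k =
  gamma ^+ 2 * (\sum_(k < K.+1) input_energy k) - \sum_(k < K.+1) residual k.
Proof.
have tele j : (j <= K.+1)%N ->
    storage j + gamma ^+ 2 * (\sum_(k < j) input_energy k) =
    storage 0 + \sum_(k < j) residual k + \sum_(k < j) output_energy k.
  elim: j => [|j IH jK]; first by rewrite !big_ord0 mulr0 !addr0.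
  rewrite !big_ord_recr /=; have := IH (ltnW jK); have := storage_step jK; lra.
have x0 : xm 0 = 0 by exact: vexp_cst.
have s0 : storage 0 = 0.
  rewrite /storage /y x0 /x /=; under eq_fun do rewrite subr0 bform0l.
  by rewrite rexp_cst bform0l addr0.
have [_ [P0 Q0] _] := PQ.
have sK : storage K.+1 = 0.
  rewrite /storage P0 Q0 bform0m addr0; under eq_fun do rewrite bform0m.
  exact: rexp_cst.
have := tele K.+1 (leqnn _); rewrite s0 sK; lra.
Qed.

Lemma state_energy0 : state_energy 0 = 0.
Proof.
have x0 : xm 0 = 0 by exact: vexp_cst.
rewrite /state_energy /y x0 /x /=.
under eq_fun do rewrite subr0 sqnormE bform0l.
by rewrite rexp_cst sqnormE bform0l addr0.
Qed.

(** The bound is averaged over [w] for the deviation and applied directly to the means. *)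
Lemma input_energy_le k c : (k <= K)%N -> 0 <= c ->
  (forall x v, sqnorm v <= c * (sqnorm x
     + bform (H k) (v + M k *m x) (v + M k *m x))) ->
  (forall x v, sqnorm v <= c * (sqnorm x
     + bform (Ht k) (v + Mt k *m x) (v + Mt k *m x))) ->
  input_energy k <= c * (state_energy k + residual k).
Proof.
move=> kK c0 hd hm; have := hm (xm k) (num k).
have iy := y_vsqint (leqW kK); have i1 := sqnorm_integ iy.
have i2 := bform_integ (H k) (res_vsqint kK) (res_vsqint kK).
have : rexp mu (fun w => sqnorm (eta k w)) <= rexp mu (fun w =>
    c * (sqnorm (y k w)
         + bform (H k) (eta k w + M k *m y k w) (eta k w + M k *m y k w))).
  apply: rexp_le => [||w]; last exact: hd.
    exact: sqnorm_integ (eta_vsqint kK).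
  by apply: integZ; exact: integD.
rewrite rexpZ; last exact: integD.
by rewrite rexpD// /input_energy /state_energy /residual; lra.
Qed.

Lemma state_energy_le k c : (k <= K)%N -> 0 <= c ->
  (forall x v, sqnorm (cA S k *m x + cB S k *m v)
     + sqnorm (cC S k *m x + cD S k *m v) <= c * (sqnorm x + sqnorm v)) ->
  (forall x v, sqnorm (sA S k *m x + sB S k *m v)
     + sqnorm (sC S k *m x + sD S k *m v) <= c * (sqnorm x + sqnorm v)) ->
  state_energy k.+1 <= c * (state_energy k + input_energy k).
Proof.
move=> kK c0 hd hm; have := hm (xm k) (num k).
have i1 := sqnorm_integ (y_vsqint (leqW kK)).
have i2 := sqnorm_integ (eta_vsqint kK).
have i3 := sqnorm_integ (aff_vsqint (cA S k) (cB S k) kK).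
have i4 := sqnorm_integ (aff_vsqint (cC S k) (cD S k) kK).
have : rexp mu (fun w => sqnorm (cA S k *m y k w + cB S k *m eta k w)
      + sqnorm (cC S k *m y k w + cD S k *m eta k w)) <=
    rexp mu (fun w => c * (sqnorm (y k w) + sqnorm (eta k w))).
  apply: rexp_le => [||w]; last exact: hd.
    exact: integD.
  by apply: integZ; exact: integD.
rewrite rexpZ; last exact: integD.
rewrite !rexpD// /state_energy /input_energy.
(* This is [covariance_step] with the identity matrix; the mean part of the noise is charged to the
   bound [hm]. *)
have -> : rexp mu (fun w => sqnorm (y k.+1 w)) =
    rexp mu (fun w => sqnorm (cA S k *m y k w + cB S k *m eta k w))
    + rexp mu (fun w => sqnorm (cC S k *m y k w + cD S k *m eta k w))
    + sqnorm (sC S k *m xm k + sD S k *m num k).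
  have sE p (X : T -> 'cV[R]_p) : rexp mu (fun w => sqnorm (X w)) =
      rexp mu (fun w => bform 1%:M (X w) (X w)).
    by congr (rexp mu _); apply/funext => w; exact: sqnormE.
  by rewrite !sE sqnormE covariance_step.
by rewrite mean_step//; lra.
Qed.

End trajectory.

(** * Uniform bounds, the norm estimate and the sign of the solution *)

Variables P Q : nat -> 'M[R]_n.
Hypothesis PQ : backward_solution S gamma K P Q.

(** The stage constants come from the matrices alone, so [C] precedes [nu]; this uniformity keeps
    the supremum strictly below [gamma]. *)
Lemma input_le_total_residual : exists2 C : R, 0 < C &
  forall nu, l2w K omega nu ->
    \sum_(k < K.+1) input_energy nu k <=
    C * \sum_(k < K.+1) residual nu P Q k.
Proof.
have bnd k : exists c : R, 0 <= c /\ ((k <= K)%N -> forall nu, l2w K omega nu ->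
    input_energy nu k <= c * (state_energy nu k + residual nu P Q k) /\
    state_energy nu k.+1 <= c * (state_energy nu k + input_energy nu k)).
  (* Beyond [K] nothing is claimed, and 0 is a default that makes the choice of constants total. *)
  case: (leqP k K) => kK; last by exists 0; split.
  have [symPQ _ /(_ k kK)[_ _ pH pHt]] := PQ; have [sP sQ] := symPQ k.+1 kK.
  have [c1 c10 h1] := stage_bounds (cA S k) (cC S k) pH.
  have [c2 c20 h2] := stage_bounds (sA S k) (sC S k) pHt.
  have mono a b u (v : R) : 0 <= u -> 0 <= b -> v <= a * u -> v <= (a + b) * u.
    by move=> u0 b0 /le_trans; apply; rewrite mulrDl lerDl mulr_ge0.
  exists (c1 + c2); split=> [|_ nu nu2]; first exact: addr_ge0.
  split.
    apply: input_energy_le => //; first exact: addr_ge0.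
      move=> x v; apply: mono => //; last by have [] := h1 x v.
      by rewrite addr_ge0 ?sqnorm_ge0 ?posdefmx_ge0.
    move=> x v; rewrite (addrC c1).
    apply: mono => //; last by have [] := h2 x v.
    by rewrite addr_ge0 ?sqnorm_ge0 ?posdefmx_ge0.
  apply: state_energy_le => //; first exact: addr_ge0.
    move=> x v; apply: mono => //; last by have [] := h1 x v.
    by rewrite addr_ge0 ?sqnorm_ge0.
  move=> x v; rewrite (addrC c1).
  apply: mono => //; last by have [] := h2 x v.
  by rewrite addr_ge0 ?sqnorm_ge0.
have [c hc] := choice bnd.
have [C C0 hC] := @input_le_residual _ K c (fun k => (hc k).1).
exists C => // nu nu2; apply: (hC (state_energy nu)).
- by move=> k kK; exact: residual_ge0.
- exact: state_energy0.
- by move=> k kK; have [_ /(_ kK nu nu2)[]] := hc k.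
- by move=> k kK; have [_ /(_ kK nu nu2)[]] := hc k.
Qed.

Lemma l2norm_energy p (z : nat -> T -> 'cV[R]_p) (e : nat -> R) :
  (forall k, (k <= K)%N -> integ mu (fun w => sqnorm (z k w))) ->
  (forall k, (k <= K)%N -> rexp mu (fun w => sqnorm (z k w)) = e k) ->
  l2norm mu K z = (Num.sqrt (\sum_(k < K.+1) e k))%:E.
Proof.
move=> zi ze; rewrite /l2norm.
rewrite (eq_bigr (fun k : 'I_K.+1 => (e k)%:E)); last first.
  by move=> k _; have kK : (k <= K)%N := ltn_ord k;
    rewrite integ_expectation ?ze//; exact: zi.
rewrite sumEFin poweR_EFin powR12_sqrt//; apply: sumr_ge0 => k _.
by rewrite -(ze k (ltn_ord k)); apply: rexp_ge0 => w; exact: sqnorm_ge0.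
Qed.

Lemma pert_norm_lt : 0 < gamma -> (pert_norm S K omega < gamma%:E)%E.
Proof.
move=> gamma_gt0; have [C C0 hC] := input_le_total_residual.
(* The radicand is not yet known to be nonnegative; were it negative, [g] would be 0, still below
   [gamma]. *)
pose g := Num.sqrt (gamma ^+ 2 - C^-1).
have g_lt : g < gamma.
  rewrite -[ltRHS](@ger0_norm _ gamma) ?ltW// -sqrtr_sqr ltr_sqrt ?exprn_gt0//.
  by rewrite gtrBl invr_gt0.
apply: (@le_lt_trans _ _ g%:E); last by rewrite lte_fin.
apply: ub_ereal_sup => _ [nu [nu2 nu0] <-].
have nuE := l2norm_energy (input_integ nu2) (rexp_input nu2).
have zE := l2norm_energy (output_integ nu2) (rexp_output nu2).
rewrite /pert_op zE; move: nu0; rewrite nuE.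
have s0 : 0 <= \sum_(k < K.+1) input_energy nu k.
  apply: sumr_ge0 => k _; rewrite -(rexp_input nu2 (ltn_ord k)).
  by apply: rexp_ge0 => w; exact: sqnorm_ge0.
have z0 : 0 <= \sum_(k < K.+1) output_energy nu k.
  apply: sumr_ge0 => k _; rewrite -(rexp_output nu2 (ltn_ord k)).
  by apply: rexp_ge0 => w; exact: sqnorm_ge0.
have := hC nu nu2; have := dissipation nu2 PQ.
move: s0 z0; set s := \sum_(k < K.+1) input_energy nu k.
set z := \sum_(k < K.+1) output_energy nu k.
set r := \sum_(k < K.+1) residual nu P Q k => s0 z0 zE' sr sN.
have s_gt0 : 0 < s.
  by rewrite lt_def s0 andbT; apply: contraNneq sN => ->; rewrite sqrtr0.
(* The bound [r >= s / C] enters the dissipation identity [z = gamma^2 s - r]. *)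
have zs : z <= (gamma ^+ 2 - C^-1) * s.
  rewrite zE' mulrBl lerD2l lerN2 mulrC ler_pdivrMr//; lra.
(* An input of positive energy makes the radicand nonnegative, as splitting the square root of the
   product requires. *)
have gs0 : 0 <= gamma ^+ 2 - C^-1.
  by rewrite -(pmulr_lge0 _ s_gt0); exact: le_trans zs.
rewrite inver gt_eqF ?sqrtr_gt0// -EFinM lee_fin ler_pdivrMr ?sqrtr_gt0//.
by rewrite -sqrtrM// ler_wsqrtr.
Qed.

(** [P] is carried along with [Q], because the step for [Q] uses the sign of [P] at the next
    time. *)
Lemma backward_solution_le0 k : (k <= K.+1)%N ->
  (forall x, bform (P k) x x <= 0) /\ (forall x, bform (Q k) x x <= 0).
Proof.
have [symPQ [P0 Q0] step] := PQ.
(* The induction runs on the distance [K.+1 - k] to the terminal time. *)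
move=> kK; rewrite -(subKn kK); have := leq_subr k K.+1.
elim: (K.+1 - k)%N => [_|j IH jK].
  by rewrite subn0 P0 Q0; split=> x; rewrite bform0m.
have [IHP IHQ] := IH (ltnW jK).
have e : (K.+1 - j = (K.+1 - j.+1).+1)%N by rewrite subnSK.
have iK : (K.+1 - j.+1 <= K)%N by rewrite subSS leq_subr.
have [sP sQ] := symPQ _ (leq_subr j K.+1).
have [-> -> pH pHt] := step _ iK; rewrite -e in pH pHt *.
by split; apply: riccati_step_le0.
Qed.

End mean_field.

Theorem theorem2p4 (R : realType) (d : measure_display) (T : measurableType d)
    (mu : probability T R) (mu_complete : measure_is_complete mu)
    (n l m K : nat) (gamma : R) (gamma_gt0 : 0 < gamma)
    (S : mf_system R n l m)
    (omega : nat -> {RV mu >-> R}) (omega_noise : mf_noise K omega)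
    (P1 Q1 : nat -> 'M[R]_n)
    (P1Q1 : unique_backward_solution S gamma K P1 Q1) :
  (pert_norm S K omega < gamma%:E)%E /\
  (forall k, (k <= K)%N -> possemidefmx (- Q1 k)).
Proof.
have [sol _] := P1Q1; split; first exact: pert_norm_lt sol gamma_gt0.
move=> k kK; have [symPQ _ _] := sol.
have [_ sQ] := symPQ k (leqW kK).
have [_ Q_le0] := backward_solution_le0 sol (leqW kK).
split=> [|v]; first by rewrite linearN /= sQ.
by change (0 <= bform (- Q1 k) v v); rewrite bformNm oppr_ge0.
Qed.
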